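(* Let $n,l>1$ be integers, $s\in\mathbb{Z}$, and let $v\mapsto\overline{v}$ be the bar involution of $\bigwedge^{s+\frac\infty2}V_{n,l}$. (i) For every $v\in\bigwedge^{s+\frac\infty2}V_{n,l}$, $$\overline{f_i(v)}=f_i(\overline{v}),\qquad\overline{f'_j(v)}=f'_j(\overline{v}),\qquad\overline{B_{-m}(v)}=B_{-m}(\overline{v}),$$ for all $i=0,1,\dots,n-1$, all $j=0,1,\dots,l-1$ and all integers $m>0$, where $f_i$ are the lowering generators of $U_q'(\widehat{\mathfrak{sl}}_n)$, $f'_j$ the lowering generators of $U_q'(\widehat{\mathfrak{sl}}_l)$, and $B_{-m}$ the Heisenberg operators. (ii) For all $\boldsymbol{s}_l=(s_1,\dots,s_l)\in\mathbb{Z}^l$ with $\sum_{b=1}^ls_b=s$ and all $\boldsymbol{s}_n=(s_1,\dots,s_n)\in\mathbb{Z}^n$ with $\sum_{a=1}^ns_a=s$, the bar involution leaves invariant the subspaces ${}^n\mathcal{F}_{\boldsymbol{s}_l}$ and ${}^l\mathcal{F}_{\boldsymbol{s}_n}$ of $\bigwedge^{s+\frac\infty2}V_{n,l}$.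
   Context: **The $q$-wedge space.** Fix integers $n>1$, $l>1$. $V_{n,l}=(V_n\otimes V_l)[z,z^{-1}]$, where $V_n$ and $V_l$ are $\mathbb{Q}(q)$-vector spaces with bases $v^{(n)}_1,\dots,v^{(n)}_n$ and $v^{(l)}_1,\dots,v^{(l)}_l$. It has the basis $u_k$ ($k\in\mathbb{Z}$), where each $k$ is written uniquely as $k=a+n(b-1)-nlm$ with $a\in\{1,\dots,n\}$, $b\in\{1,\dots,l\}$, $m\in\mathbb{Z}$, and $u_k=v^{(n)}_a z^m v^{(l)}_b$. We always write $k_i=a_i+n(b_i-1)-nlm_i$ in this way. For a statement $P$, $\delta(P)=1$ if $P$ is true and $0$ otherwise. $\bigwedge^2V_{n,l}$ is the $\mathbb{Q}(q)$-space generated by the monomials $u_{k_1}\wedge u_{k_2}$ modulo the following relations, one for each pair $k_1\le k_2$. Let $\alpha,\beta\in\{0,\dots,nl-1\}$ be the residues of $a_2-a_1$ and $n(b_2-b_1)$ modulo $nl$. (Ri) If $\alpha=\beta=0$: $u_{k_1}\wedge u_{k_2}=-u_{k_2}\wedge u_{k_1}$. (Rii) If $\alpha>0,\beta=0$: $u_{k_1}\wedge u_{k_2}=-q^{-1}u_{k_2}\wedge u_{k_1}+(q^{-2}-1)\{\sum_{m\ge0}q^{-2m}u_{k_2-\alpha-nlm}\wedge u_{k_1+\alpha+nlm}-\sum_{m\ge1}q^{-2m+1}u_{k_2-nlm}\wedge u_{k_1+nlm}\}$. (Riii) If $\alpha=0,\beta>0$: $u_{k_1}\wedge u_{k_2}=-q\,u_{k_2}\wedge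 u_{k_1}+(q^{2}-1)\{\sum_{m\ge0}q^{2m}u_{k_2-\beta-nlm}\wedge u_{k_1+\beta+nlm}-\sum_{m\ge1}q^{2m-1}u_{k_2-nlm}\wedge u_{k_1+nlm}\}$. (Riv) If $\alpha,\beta>0$: $u_{k_1}\wedge u_{k_2}=-u_{k_2}\wedge u_{k_1}+(q-q^{-1})\sum_{m\ge0}\frac{q^{2m+1}+q^{-2m-1}}{q+q^{-1}}u_{k_2-\beta-nlm}\wedge u_{k_1+\beta+nlm}-(q-q^{-1})\sum_{m\ge0}\frac{q^{2m+1}+q^{-2m-1}}{q+q^{-1}}u_{k_2-\alpha-nlm}\wedge u_{k_1+\alpha+nlm}+(q-q^{-1})\sum_{m\ge1}\frac{q^{2m}-q^{-2m}}{q+q^{-1}}u_{k_2+nl-\alpha-\beta-nlm}\wedge u_{k_1-nl+\alpha+\beta+nlm}-(q-q^{-1})\sum_{m\ge1}\frac{q^{2m}-q^{-2m}}{q+q^{-1}}u_{k_2-nlm}\wedge u_{k_1+nlm}$. All sums continue only as long as the monomials $u_c\wedge u_d$ in them are ordered, i.e. $c>d$. $\bigwedge^rV_{n,l}$ is generated by $u_{k_1}\wedge\cdots\wedge u_{k_r}$ modulo these relations in each adjacent pair of factors; the ordered monomials ($k_1>\cdots>k_r$) form a basis. For $s\in\mathbb{Z}$, $\bigwedge^{s+\frac\infty2}V_{n,l}$ is the inductive limit of the $\bigwedge^rV_{n,l}$ along $v\mapsto v\wedge u_{s-r}$; it is spanned by semi-infinite monomials $u_{k_1}\wedge u_{k_2}\wedge\cdots$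 with $k_i=s-i+1$ for $i\gg1$, and the ordered ones ($k_1>k_2>\cdots$) form a basis. **Operators.** With $v^{(n)}_{n+1}=v^{(n)}_1$, $v^{(l)}_{l+1}=v^{(l)}_1$, define on $V_{n,l}$: $t_i(v^{(n)}_az^mv^{(l)}_b)=q^{\delta(i\equiv a\bmod n)-\delta(i+1\equiv a\bmod n)}v^{(n)}_az^mv^{(l)}_b$, $f_i(v^{(n)}_az^mv^{(l)}_b)=\delta(i\equiv a\bmod n)v^{(n)}_{a+1}z^{m-\delta(i=0)}v^{(l)}_b$ for $0\le i\le n-1$ (generators of $U_q'(\widehat{\mathfrak{sl}}_n)$); $t'_j(v^{(n)}_az^mv^{(l)}_b)=q^{\delta(j\equiv b\bmod l)-\delta(j+1\equiv b\bmod l)}v^{(n)}_az^mv^{(l)}_b$, $f'_j(v^{(n)}_az^mv^{(l)}_b)=\delta(j\equiv b\bmod l)v^{(n)}_{a}z^{m-\delta(j=0)}v^{(l)}_{b+1}$ for $0\le j\le l-1$ (generators of $U_q'(\widehat{\mathfrak{sl}}_l)$). On a semi-infinite monomial $u=u_{k_1}\wedge u_{k_2}\wedge\cdots$: $f_i(u)=\sum_{p\ge1}t_i(u_{k_1})\wedge\cdots\wedge t_i(u_{k_{p-1}})\wedge f_i(u_{k_p})\wedge u_{k_{p+1}}\wedge\cdots$, $f'_j(u)=\sum_{p\ge1}(t'_j)^{-1}(u_{k_1})\wedge\cdots\wedge(t'_j)^{-1}(u_{k_{p-1}})\wedge f'_j(u_{k_p})\wedge u_{k_{p+1}}\wedge\cdots$,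 and for nonzero $m\in\mathbb{Z}$, $B_m(u)=\sum_{p\ge1}u_{k_1}\wedge\cdots\wedge u_{k_{p-1}}\wedge u_{k_p-nlm}\wedge u_{k_{p+1}}\wedge\cdots$. In each sum only finitely many terms are nonzero, and these are well-defined linear operators on $\bigwedge^{s+\frac\infty2}V_{n,l}$. **Bar involution.** For a semi-infinite monomial (ordered or not) $u=u_{k_1}\wedge u_{k_2}\wedge\cdots\in\bigwedge^{s+\frac\infty2}V_{n,l}$ put $\deg(u)=\sum_{i\ge1}(k_i-(s-i+1))$ and, for a non-negative integer $r$, $C_r(u)=\sum_{1\le i<j\le r}(\delta(b_i=b_j)-\delta(a_i=a_j))$. For $r\ge\deg(u)$ put $\overline{u}=(-1)^{r(r-1)/2}q^{C_r(u)}u_{k_r}\wedge u_{k_{r-1}}\wedge\cdots\wedge u_{k_1}\wedge u_{k_{r+1}}\wedge u_{k_{r+2}}\wedge\cdots$, which the paper states to be independent of $r$. For a collection of monomials $\{u^{(i)}\}$ and $c_i(q)\in\mathbb{Q}(q)$, the semi-linear map $v\mapsto\overline{v}$ of $\bigwedge^{s+\frac\infty2}V_{n,l}$ is defined by $\overline{\sum_ic_i(q)u^{(i)}}=\sum_ic_i(q^{-1})\overline{u^{(i)}}$. It is a degree-preserving involution, called here the bar involution. **Subspaces.** To an ordered monomial $u_{k_1}\wedge u_{k_2}\wedge\cdots\in\bigwedge^{s+\frac\infty2}V_{n,l}$ attach $\boldsymbol{s}_l=(s_1,\dots,s_l)$ as follows: for each $b\in\{1,\dots,l\}$ arrange $\{a_i-nm_i\mid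 b_i=b\}$ as $k^{(b)}_1>k^{(b)}_2>\cdots$; $s_b$ is the unique integer with $k^{(b)}_i=s_b-i+1$ for $i\gg1$. Similarly attach $\boldsymbol{s}_n=(s_1,\dots,s_n)$: for each $a\in\{1,\dots,n\}$ arrange $\{b_i-lm_i\mid a_i=a\}$ as $k^{(a)}_1>k^{(a)}_2>\cdots$; $s_a$ is the unique integer with $k^{(a)}_i=s_a-i+1$ for $i\gg1$. Then ${}^n\mathcal{F}_{\boldsymbol{s}_l}$ (resp. ${}^l\mathcal{F}_{\boldsymbol{s}_n}$) is the span of all ordered monomials whose attached $l$-tuple is $\boldsymbol{s}_l$ (resp. whose attached $n$-tuple is $\boldsymbol{s}_n$).
   Formalization: In defining the bar of an unordered monomial, r must satisfy, besides r ≥ deg(u), that the factors after the r-th are u_{s-r}, u_{s-r-1}, … and the first r have index > s-r; with r ≥ deg(u) alone the result depends on r. For ordered monomials nothing changes. *)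

(* Defs.v *)
From HB Require Import structures.
From mathcomp Require Import all_boot all_order all_algebra.
From mathcomp Require Import finmap boolp zify.
From mathcomp.multinomials Require Import monalg.

Set Implicit Arguments.
Unset Strict Implicit.
Unset Printing Implicit Defensive.

Import Order.TTheory GRing.Theory Num.Theory.
Local Open Scope ring_scope.
Local Open Scope quotient_scope.

Definition Qq : fieldType := {fraction {poly rat}}.

Definition q : Qq := FracField.tofrac 'X.

Definition eval_qinv (p : {poly rat}) : Qq :=
  (map_poly (fun c : rat => FracField.tofrac c%:P : Qq) p).[q^-1].

(* c(q) |-> c(q^-1), on the numerator and denominator of c. *)
Definition qbar (c : Qq) : Qq :=
  eval_qinv \n_(repr c) / eval_qinv \d_(repr c).

Section Span.
Variables (K : nzRingType) (V : lmodType K).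

Definition in_span (S : V -> Prop) (v : V) : Prop :=
  exists cs : seq (K * V),
    (forall c, c \in cs -> S c.2) /\ v = \sum_(c <- cs) c.1 *: c.2.

Lemma in_span_submod (S : V -> Prop) :
  submod_closed (fun v : V => `[< in_span S v >]).
Proof.
split.
  by apply/asboolP; exists [::]; split=> //; rewrite big_nil.
move=> c u v /asboolP[cs [Scs ->]] /asboolP[ds [Sds ->]]; apply/asboolP.
exists ([seq (c * x.1, x.2) | x <- cs] ++ ds); split.
  by move=> x; rewrite mem_cat => /orP[/mapP[y /Scs Sy ->]|/Sds].
rewrite big_cat big_map scaler_sumr; congr (_ + _).
by apply: eq_bigr => x _; rewrite scalerA.
Qed.

End Span.

Section Indices.
Variables n l : nat.

Definition idx_a (k : int) : int := ((k - 1) %% n)%Z + 1.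
Definition idx_b (k : int) : int := (((k - 1) %/ n)%Z %% l)%Z + 1.
Definition idx_m (k : int) : int := - ((k - 1) %/ (n * l)%N)%Z.
Definition idx_of (a b m : int) : int := a + n%:Z * (b - 1) - (n * l)%N%:Z * m.

Lemma idx_ofK (a b m : int) : 1 <= a <= n%:Z -> 1 <= b <= l%:Z ->
  [/\ idx_a (idx_of a b m) = a, idx_b (idx_of a b m) = b
    & idx_m (idx_of a b m) = m].
Proof.
move=> /andP[a1 an] /andP[b1 bl].
have n0 : n%:Z != 0 by lia.
have l0 : l%:Z != 0 by lia.
have E : idx_of a b m - 1 = (- m * l%:Z + (b - 1)) * n%:Z + (a - 1).
  by rewrite /idx_of PoszM; lia.
have D : ((idx_of a b m - 1) %/ n)%Z = - m * l%:Z + (b - 1).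
  by rewrite E divzMDl // divz_small ?addr0 //; lia.
split.
- by rewrite /idx_a E modzMDl modz_small; lia.
- by rewrite /idx_b D modzMDl modz_small; lia.
- by rewrite /idx_m PoszM divzMA_ge0 ?D ?divzMDl // ?divz_small; lia.
Qed.

Lemma idx_of_surj (k : int) : (0 < n)%N -> (0 < l)%N ->
  [/\ 1 <= idx_a k <= n%:Z, 1 <= idx_b k <= l%:Z
    & idx_of (idx_a k) (idx_b k) (idx_m k) = k].
Proof.
move=> n0 l0; have nz : n%:Z != 0 by lia. have lz : l%:Z != 0 by lia.
have := modz_ge0 (k - 1) nz; have := ltz_mod (k - 1) nz.
have := modz_ge0 ((k - 1) %/ n)%Z lz; have := ltz_mod ((k - 1) %/ n)%Z lz.
rewrite /idx_of /idx_a /idx_b /idx_m PoszM divzMA_ge0 //.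
have := divz_eq ((k - 1) %/ n)%Z l; have := divz_eq (k - 1) n.
move: ((k - 1) %/ n)%Z => d; move: (d %% l)%Z (d %/ l)%Z => u v.
move: ((k - 1) %% n)%Z => w Ek Ed ? ? ? ?; split; lia.
Qed.

(* alpha and beta *)
Definition res_a (k1 k2 : int) : int :=
  ((idx_a k2 - idx_a k1) %% (n * l)%N)%Z.
Definition res_b (k1 k2 : int) : int :=
  ((n%:Z * (idx_b k2 - idx_b k1)) %% (n * l)%N)%Z.

Section Exchange.
Variables (V : lmodType Qq) (w : int -> int -> V).

(* The sum over m >= m0 of x(m) w(c - nlm, d + nlm), continued only as long as
   c - nlm > d + nlm; this forces m < |c - d|. *)
Definition ord_sum (m0 : nat) (x : nat -> Qq) (c d : int) : V :=
  \sum_(m0 <= m < `|c - d|%N |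
        d + (n * l * m)%N%:Z < c - (n * l * m)%N%:Z)
     x m *: w (c - (n * l * m)%N%:Z) (d + (n * l * m)%N%:Z).

Definition exchange_rhs (k1 k2 : int) : V :=
  let al := res_a k1 k2 in
  let be := res_b k1 k2 in
  let nl := (n * l)%N%:Z in
  let odd_q m := (q ^ (2 * m%:Z + 1) + q ^ (- 2 * m%:Z - 1)) / (q + q^-1) in
  let even_q m := (q ^ (2 * m%:Z) - q ^ (- 2 * m%:Z)) / (q + q^-1) in
  if (al == 0) && (be == 0) then - w k2 k1
  else if be == 0 then
    - q^-1 *: w k2 k1
    + (q ^ (-2) - 1) *:
       (ord_sum 0 (fun m => q ^ (- 2 * m%:Z)) (k2 - al) (k1 + al)
        - ord_sum 1 (fun m => q ^ (- 2 * m%:Z + 1)) k2 k1)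
  else if al == 0 then
    - q *: w k2 k1
    + (q ^ 2 - 1) *:
       (ord_sum 0 (fun m => q ^ (2 * m%:Z)) (k2 - be) (k1 + be)
        - ord_sum 1 (fun m => q ^ (2 * m%:Z - 1)) k2 k1)
  else
    - w k2 k1
    + (q - q^-1) *: ord_sum 0 odd_q (k2 - be) (k1 + be)
    - (q - q^-1) *: ord_sum 0 odd_q (k2 - al) (k1 + al)
    + (q - q^-1) *: ord_sum 1 even_q (k2 + nl - al - be) (k1 - nl + al + be)
    - (q - q^-1) *: ord_sum 1 even_q k2 k1.

End Exchange.
End Indices.

Section SemiInfiniteWedge.
Variables (n l : nat) (s : int).

(* The free space on all finite sequences is the direct sum over r of the free
   spaces on the monomials u_{k_1} ^ ... ^ u_{k_r}. Its quotient by the first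
   family of relations is the direct sum of the r-th wedge powers, and the
   second family identifies v with v ^ u_{s-r}: the quotient by both is the
   inductive limit. *)
Inductive wedge_relator : {malg Qq[seq int]} -> Prop :=
| Exchange (pre post : seq int) (k1 k2 : int) of k1 <= k2 :
    let w c d : {malg Qq[seq int]} := << pre ++ [:: c, d & post] >> in
    wedge_relator (w k1 k2 - exchange_rhs n l w k1 k2)
| Stabilize (k : seq int) :
    wedge_relator (<< k >> - << rcons k (s - (size k)%:Z) >>).

Definition wedge_relations : {pred {malg Qq[seq int]}} :=
  fun x => `[< in_span wedge_relator x >].

Lemma wedge_relations_submod : submod_closed wedge_relations.
Proof. exact: in_span_submod. Qed.

HB.instance Definition _ :=
  GRing.isSubmodClosed.Build Qq {malg Qq[seq int]} wedge_relations
    wedge_relations_submod.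

Definition semi_wedge : Type := {ideal_quot wedge_relations}.
HB.instance Definition _ := GRing.Zmodule.on semi_wedge.
HB.instance Definition _ : EqQuotient _ _ semi_wedge := EqQuotient.on semi_wedge.


Definition semi_scale (c : Qq) (x : semi_wedge) : semi_wedge :=
  \pi_semi_wedge (c *: repr x).

Lemma pi_semi_scale c (x : {malg Qq[seq int]}) :
  semi_scale c (\pi_semi_wedge x) = \pi_semi_wedge (c *: x).
Proof.
apply/eqP; rewrite -(Quotient.idealrBE wedge_relations) -scalerBr rpredZ //.
by rewrite Quotient.idealrBE reprK.
Qed.

Lemma semi_scaleA a b x :
  semi_scale a (semi_scale b x) = semi_scale (a * b) x.
Proof. by elim/quotW: x => x; rewrite (pi_semi_scale b) !pi_semi_scale scalerA. Qed.

Lemma semi_scale1 : left_id 1 semi_scale.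
Proof. by elim/quotW => x; rewrite pi_semi_scale scale1r. Qed.

Lemma semi_scaleDr : right_distributive semi_scale +%R.
Proof.
move=> a; elim/quotW => x; elim/quotW => y.
rewrite -[X in semi_scale a X]Quotient.pi_add !pi_semi_scale scalerDr.
exact: Quotient.pi_add.
Qed.

Lemma semi_scaleDl x : {morph semi_scale^~ x : a b / a + b}.
Proof.
elim/quotW: x => x a b; rewrite !pi_semi_scale scalerDl.
exact: Quotient.pi_add.
Qed.

HB.instance Definition _ :=
  GRing.Zmodule_isLmodule.Build Qq semi_wedge
    semi_scaleA semi_scale1 semi_scaleDr semi_scaleDl.

(* The finite sequence k_1, ..., k_r stands for the semi-infinite monomial
   u_{k_1} ^ ... ^ u_{k_r} ^ u_{s-r} ^ u_{s-r-1} ^ ...; entry k i is the index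
   of its factor number i + 1. Different sequences may stand for the same
   monomial; they have the same class by Stabilize. *)
Definition entry (k : seq int) (i : nat) : int :=
  if (i < size k)%N then nth 0 k i else s - i%:Z.

Definition monomial (k : seq int) : semi_wedge := \pi_semi_wedge << k >>.

(* the monomial k with its factor number p + 1 replaced by u_x *)
Definition replace_factor (k : seq int) (p : nat) (x : int) : semi_wedge :=
  monomial (mkseq (fun i => if i == p then x else entry k i)
                  (maxn (size k) p.+1)).

(* x is the sum over all p of a sequence with finitely many nonzero terms *)
Definition is_finite_sum (t : nat -> semi_wedge) (x : semi_wedge) : Prop :=
  exists N : nat, (forall p, (N <= p)%N -> t p = 0)
    /\ x = \sum_(0 <= p < N) t p.

(* t_i u_k = q ^ wt_a i k u_k and t'_j u_k = q ^ wt_b j k u_k *)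
Definition wt_a (i : nat) (k : int) : int :=
  (i == idx_a n k %[mod n])%Z%:Z - (i.+1 == idx_a n k %[mod n])%Z%:Z.
Definition wt_b (j : nat) (k : int) : int :=
  (j == idx_b n l k %[mod l])%Z%:Z - (j.+1 == idx_b n l k %[mod l])%Z%:Z.

(* f_i u_k = u_(lower_a i k) if i = a mod n, and 0 otherwise *)
Definition lower_a (i : nat) (k : int) : int :=
  let a := idx_a n k in
  idx_of n l (if a == n%:Z then 1 else a + 1) (idx_b n l k)
    (idx_m n l k - (i == 0%N)%:Z).
Definition lower_b (j : nat) (k : int) : int :=
  let b := idx_b n l k in
  idx_of n l (idx_a n k) (if b == l%:Z then 1 else b + 1)
    (idx_m n l k - (j == 0%N)%:Z).

Definition is_lowering_a (i : nat) (f : semi_wedge -> semi_wedge) : Prop :=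
  forall k : seq int, is_finite_sum (fun p =>
    if (i == idx_a n (entry k p) %[mod n])%Z then
      q ^ (\sum_(0 <= j < p) wt_a i (entry k j))
        *: replace_factor k p (lower_a i (entry k p))
    else 0) (f (monomial k)).

Definition is_lowering_b (j : nat) (f : semi_wedge -> semi_wedge) : Prop :=
  forall k : seq int, is_finite_sum (fun p =>
    if (j == idx_b n l (entry k p) %[mod l])%Z then
      q ^ (- \sum_(0 <= i < p) wt_b j (entry k i))
        *: replace_factor k p (lower_b j (entry k p))
    else 0) (f (monomial k)).

Definition is_heisenberg (m : int) (B : semi_wedge -> semi_wedge) : Prop :=
  forall k : seq int, is_finite_sum (fun p =>
    replace_factor k p (entry k p - (n * l)%N%:Z * m)) (B (monomial k)).

Definition degree (k : seq int) : int :=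
  \sum_(0 <= i < size k) (entry k i - (s - i%:Z)).

Definition bar_exponent (r : nat) (k : seq int) : int :=
  \sum_(0 <= j < r) \sum_(0 <= i < j)
    ((idx_b n l (entry k i) == idx_b n l (entry k j))%:Z
     - (idx_a n (entry k i) == idx_a n (entry k j))%:Z).

Definition ordered (k : seq int) : Prop :=
  forall i : nat, entry k i.+1 < entry k i.

(* The lengths r of the initial segment that the bar involution may reverse:
   r >= deg u, the factors after the r-th are u_{s-r} ^ u_{s-r-1} ^ ..., and
   the first r ones have indices > s - r. For an ordered monomial the last two
   conditions follow from the first (ordered_bar_length). For an unordered one
   the first alone does not make the result independent of r: when s - 1 and s
   have the same b, the monomial u_{s-1} ^ u_s ^ u_{s-2} ^ ... is equal to
   - q^-1 u_s ^ u_{s-1} ^ u_{s-2} ^ ... and has degree 0, but r = 0 would map it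
   to itself and r = 2 to - q u_s ^ u_{s-1} ^ u_{s-2} ^ ... *)
Definition bar_length (r : nat) (k : seq int) : Prop :=
  [/\ degree k <= r%:Z,
      forall i, (r <= i)%N -> entry k i = s - i%:Z
    & forall i, (i < r)%N -> s - r%:Z < entry k i].

Lemma ordered_bar_length (r : nat) (k : seq int) :
  ordered k -> degree k <= r%:Z -> bar_length r k.
Proof.
move=> ok dk.
have ge_vac i : s - i%:Z <= entry k i.
  have [ki|ik] := leqP (size k) i; first by rewrite /entry ltnNge ki.
  suff H d : forall j, (j + d = size k)%N -> s - j%:Z <= entry k j.
    by apply: (H (size k - i)%N); rewrite subnKC // ltnW.
  elim: d => [|d IH] j jd; first by rewrite /entry -jd addn0 ltnn.
  have H1 : s - j.+1%:Z <= entry k j.+1 by apply: IH; rewrite addSnnS.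
  move: (ok j) H1; move: (entry k j) (entry k j.+1) => u v; clear; lia.
have anti i j : (i <= j)%N -> entry k j + (j - i)%N%:Z <= entry k i.
  elim: j => [|j IH] ij; first by case: i ij => // _; rewrite addr0.
  have [->|lt_ij] := eqVneq i j.+1; first by rewrite subnn addr0.
  have := IH ltac:(lia); move: (ok j).
  by move: (entry k i) (entry k j) (entry k j.+1) => u v w; clear -lt_ij ij; lia.
have vac i : (r <= i)%N -> entry k i = s - i%:Z.
  move=> ri; apply/eqP; rewrite eq_le ge_vac andbT leNgt; apply/negP => lt_i.
  have ik : (i < size k)%N.
    by rewrite ltnNge; apply/negP => ki; move: lt_i; rewrite /entry ltnNge ki ltxx.
  suff : i.+1%:Z <= degree k by lia.
  rewrite /degree (big_cat_nat (n := i.+1)) //=.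
  rewrite -[X in X <= _]addr0; apply: lerD; last first.
    by apply: sumr_ge0 => j _; rewrite subr_ge0 ge_vac.
  have -> : i.+1%:Z = \sum_(0 <= j < i.+1) 1 :> int.
    by rewrite sumr_const_nat subn0 natz.
  apply: ler_sum_nat => j /andP[_ ji]; move: (anti j i ji) lt_i.
  by move: (entry k i) (entry k j) => u v; clear -ji; lia.
split=> // i ir; move: (ge_vac i); move: (entry k i) => u; clear -ir; lia.
Qed.

Definition is_bar_involution (bar : semi_wedge -> semi_wedge) : Prop :=
  (forall c x y, bar (c *: x + y) = qbar c *: bar x + bar y) /\
  (forall (k : seq int) (r : nat), bar_length r k ->
     bar (monomial k) = ((-1) ^+ (r * r.-1)./2 * q ^ bar_exponent r k)
       *: monomial (rev (mkseq (entry k) r))).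

(* x i is the element k_(i+1) of the decreasing arrangement of X. *)
Definition is_charge (X : int -> Prop) (c : int) : Prop :=
  exists x : nat -> int,
    [/\ forall i, x i.+1 < x i,
        forall y, X y <-> exists i, x i = y
      & exists N : nat, forall i, (N <= i)%N -> x i = c - i%:Z].

Definition has_charges_l (k : seq int) (sl : 'I_l -> int) : Prop :=
  forall b : 'I_l, is_charge (fun y => exists i, let ki := entry k i in
    idx_b n l ki = b.+1%:Z /\ y = idx_a n ki - n%:Z * idx_m n l ki) (sl b).

Definition has_charges_n (k : seq int) (sn : 'I_n -> int) : Prop :=
  forall a : 'I_n, is_charge (fun y => exists i, let ki := entry k i in
    idx_a n ki = a.+1%:Z /\ y = idx_b n l ki - l%:Z * idx_m n l ki) (sn a).

Definition fock_l (sl : 'I_l -> int) : semi_wedge -> Prop :=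
  in_span (fun v => exists k, [/\ ordered k, has_charges_l k sl
                                & v = monomial k]).

Definition fock_n (sn : 'I_n -> int) : semi_wedge -> Prop :=
  in_span (fun v => exists k, [/\ ordered k, has_charges_n k sn
                                & v = monomial k]).

End SemiInfiniteWedge.

(* Main.v *)
Require Import Defs.
From mathcomp Require Import all_boot all_order all_algebra.
From mathcomp Require Import boolp zify ring.
From mathcomp.multinomials Require Import monalg.

Set Implicit Arguments.
Unset Strict Implicit.
Unset Printing Implicit Defensive.

Import Order.TTheory GRing.Theory Num.Theory.
Local Open Scope ring_scope.
Local Open Scope quotient_scope.

(** Why the theorem holds.

A monomial may be padded with vacuum factors at will, and once the padded
length [r] is large the bar involution reverses exactly its first [r] factors,
up to a sign and the power of q given by the number of coincidences among the
[b]'s minus that among the [a]'s. So the bar of every monomial is known, not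
only that of the ordered ones, and (i) becomes a comparison of coefficients.

The operators f_i, f'_j and B_{-m} have a common shape: a sum over the factors
of terms in which one factor [x] is raised to [g x], with a power of q that
collects weights [om] of the factors on its left. Take [r] large. The terms
raising a factor beyond the [r]-th vanish: straightening such a monomial keeps
its sum, its length and a lower bound on its entries, and no strictly
decreasing word has a sum that small ([monomial_low_sum]). Among the terms
raising one of the first [r] factors, bar followed by the operator collects the
weights to the right of the raised factor, because the word has been reversed.
The operator followed by bar inverts the weights to the left and changes the
exponent of the bar involution by the sum of the weights of all the other
factors, because raising [x] changes its coincidence with [y] by exactly [om
y]. The two results agree ([bar_factorwise]).

For (ii), an exchange relation replaces a pair of entries by pairs inside the
interval which they span, with the same multiset of [a]'s and of [b]'s.
Hence the reversed word is a combination of strictly decreasing words with the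
same length, the same [a]'s and the same [b]'s ([straighten]). The charge
attached to a colour is that of the vacuum tail plus the number of factors of
this colour before the tail ([colour_charge]), so all these words have the
charges of the word that was reversed. *)

(** * Inverting the variable q *)

Lemma frac_numden (R : idomainType) (c : {fraction R}) :
  c * FracField.tofrac \d_(repr c) = FracField.tofrac \n_(repr c).
Proof.
rewrite -[c in c * _]reprK; move: (repr c) => x.
rewrite !piE; apply/eqP; rewrite piE /= FracField.equivfE /FracField.mulf.
by rewrite !numden_Ratio ?mulf_neq0 ?oner_eq0 ?denom_ratioP ?mulr1 // mulrC.
Qed.

Lemma eval_qinvE (p : {poly rat}) :
  eval_qinv p = (map_poly (@FracField.tofrac {poly rat} \o polyC) p).[q^-1].
Proof. by []. Qed.

Lemma eval_qinvM p r : eval_qinv (p * r) = eval_qinv p * eval_qinv r.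
Proof. by rewrite !eval_qinvE rmorphM hornerM. Qed.

Lemma q_neq0 : q != 0.
Proof. by rewrite /q tofrac_eq0 polyX_eq0. Qed.

Lemma eval_qinvXn k : eval_qinv 'X^k = q^-1 ^+ k.
Proof. by rewrite eval_qinvE map_polyXn hornerXn. Qed.

(** Clearing denominators turns the value at q^-1 into the reversed polynomial,
whose coefficients are those of [p] in the opposite order. *)
Lemma eval_qinv_neq0 p : p != 0 -> eval_qinv p != 0.
Proof.
move=> p0; apply/eqP => ev0.
suff : FracField.tofrac (\sum_(i < size p) (p`_i)%:P * 'X^((size p).-1 - i))
         = 0 :> Qq.
  move=> /eqP; rewrite tofrac_eq0 => /eqP /(congr1 (fun r : {poly rat} => r`_0)).
  rewrite coef0 coef_sum.
  have sz : ((size p).-1 < size p)%N by rewrite prednK // size_poly_gt0.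
  rewrite (bigD1 (Ordinal sz)) //= subnn expr0 mulr1 coefC eqxx big1 ?addr0.
    by move/eqP; rewrite -[_ == _]/(lead_coef p == 0) lead_coef_eq0 (negPf p0).
  move=> i ni; rewrite coefCM coefXn; case: eqP; last by rewrite mulr0.
  by move=> Ei; case/eqP: ni; apply: val_inj => /=;
    move: (nat_of_ord i) (ltn_ord i) Ei => j; lia.
rewrite -[RHS](mul0r (q ^+ (size p).-1)) -[in RHS]ev0 eval_qinvE.
rewrite horner_coef size_map_inj_poly; last 2 first.
- by move=> x y /eqP; rewrite tofrac_eq => /eqP /polyC_inj.
- exact: rmorph0.
rewrite rmorph_sum /= mulr_suml; apply: eq_bigr => i _.
rewrite coef_map /= tofracM tofracXn -mulrA; congr (_ * _).
have iN : (i <= (size p).-1)%N by rewrite -ltnS prednK ?size_poly_gt0.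
rewrite -[_ 'X]/q -[in RHS](subnK iN) exprD exprVn mulrCA mulVf ?mulr1 //.
by rewrite expf_neq0 // q_neq0.
Qed.

Lemma qbarXz (z : int) : qbar (q ^ z) = q ^ (- z).
Proof.
rewrite /qbar.
have d0 : eval_qinv \d_(repr (q ^ z)) != 0 by apply/eval_qinv_neq0/denom_ratioP.
apply: (mulIf d0); rewrite divfK //.
move: d0 (frac_numden (q ^ z)) => _.
move: {1 2}(\n_ _) {1 2}(\d_ _) => n d.
case: z => k Enum.
  have -> : n = 'X^k * d.
    by apply/eqP; rewrite -tofrac_eq -Enum tofracM tofracXn.
  by rewrite eval_qinvM eval_qinvXn exprVn exprnN.
have -> : d = 'X^(k.+1) * n.
  apply/eqP; rewrite -tofrac_eq tofracM -Enum tofracXn NegzE -exprnN mulrA.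
  by rewrite mulfV ?mul1r // expf_neq0 // q_neq0.
rewrite eval_qinvM eval_qinvXn mulrA NegzE opprK -exprMn.
by rewrite divff ?q_neq0 // expr1n mul1r.
Qed.

Lemma qbar1 : qbar 1 = 1.
Proof. by have := qbarXz 0; rewrite oppr0 expr0z. Qed.

(** * Linear spans *)

Section SpanClosure.
Variables (K : nzRingType) (V : lmodType K) (S : V -> Prop).

Lemma in_span_gen v : S v -> in_span S v.
Proof.
exists [:: (1, v)]; rewrite big_seq1 scale1r; split=> // c.
by rewrite inE => /eqP->.
Qed.

Lemma in_span_comb c u v : in_span S u -> in_span S v -> in_span S (c *: u + v).
Proof.
move=> /asboolP Su /asboolP Sv; apply/asboolP.
by case: (in_span_submod S) => _; apply.
Qed.

Lemma in_span0 : in_span S 0.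
Proof. by apply/asboolP; case: (in_span_submod S). Qed.

Lemma in_spanZ c u : in_span S u -> in_span S (c *: u).
Proof. by move=> Su; rewrite -[_ *: u]addr0; apply: in_span_comb in_span0. Qed.

Lemma in_spanD u v : in_span S u -> in_span S v -> in_span S (u + v).
Proof. by move=> Su Sv; rewrite -[u]scale1r; apply: in_span_comb. Qed.

Lemma in_spanN u : in_span S u -> in_span S (- u).
Proof. by rewrite -scaleN1r; apply: in_spanZ. Qed.

Lemma in_span_sum (I : Type) (r : seq I) (P : pred I) (F : I -> V) :
  (forall i, P i -> in_span S (F i)) -> in_span S (\sum_(i <- r | P i) F i).
Proof.
by move=> SF; elim/big_ind: _ => //; [apply: in_span0 | apply: in_spanD].
Qed.

End SpanClosure.

Lemma in_span_sub (K : nzRingType) (V : lmodType K) (S T : V -> Prop) v :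
  (forall u, S u -> in_span T u) -> in_span S v -> in_span T v.
Proof.
move=> ST [cs [Scs ->]]; rewrite big_seq; apply: in_span_sum => c /Scs/ST.
exact: in_spanZ.
Qed.

(** * Monomials and relations in the semi-infinite wedge space *)

Section Wedge.
Variables (n l : nat) (s : int).
Hypotheses (n_gt0 : (0 < n)%N) (l_gt0 : (0 < l)%N).

Lemma pi_wedgeD : {morph \pi_(semi_wedge n l s) : x y / x + y >-> x + y}.
Proof. by move=> x y; rewrite -[RHS]Quotient.pi_add. Qed.

Lemma pi_wedgeZ c x :
  \pi_(semi_wedge n l s) (c *: x) = c *: \pi_(semi_wedge n l s) x.
Proof. by rewrite -[RHS]/(semi_scale c _) pi_semi_scale. Qed.

Lemma pi_wedge_sum (I : Type) (r : seq I) (F : I -> {malg Qq[seq int]}) :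
  \pi_(semi_wedge n l s) (\sum_(i <- r) F i) =
  \sum_(i <- r) \pi_(semi_wedge n l s) (F i).
Proof.
apply: (big_morph _ pi_wedgeD).
by rewrite -[X in \pi X](scale0r 0) pi_wedgeZ scale0r.
Qed.

Lemma pi_wedge_rel x y : wedge_relator n l s (x - y) ->
  \pi_(semi_wedge n l s) x = \pi y.
Proof.
move=> rxy; apply/eqP; rewrite -(Quotient.idealrBE (wedge_relations n l s)).
exact/asboolP/in_span_gen.
Qed.

Lemma in_span_monomial (v : semi_wedge n l s) :
  in_span (fun u => exists k, u = monomial n l s k) v.
Proof.
rewrite -[v]reprK; move: (repr v) => g; rewrite [g]monalgE pi_wedge_sum.
apply: in_span_sum => k _.
have -> : << g@_k *g k >> = g@_k *: << k >> :> {malg Qq[seq int]}.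
  by apply/malgP => k'; rewrite mcoeffZ !mcoeffU mulrnAr mulr1.
by rewrite pi_wedgeZ; apply/in_spanZ/in_span_gen; exists k.
Qed.

Lemma monomial_rcons k :
  monomial n l s (rcons k (s - (size k)%:Z)) = monomial n l s k.
Proof. by apply/esym/pi_wedge_rel/Stabilize. Qed.

Lemma monomial_pad k r : (size k <= r)%N ->
  monomial n l s (mkseq (entry s k) r) = monomial n l s k.
Proof.
move=> /subnKC <-; elim: (r - size k)%N => [|d IH].
  rewrite addn0; congr monomial; apply: (@eq_from_nth _ 0); rewrite size_mkseq //.
  by move=> i ik; rewrite nth_mkseq // /entry ik.
rewrite addnS mkseqS -IH -[in RHS]monomial_rcons size_mkseq /entry.
by rewrite ltnNge leq_addr.
Qed.

Lemma exchange (pre post : seq int) (k1 k2 : int) : k1 <= k2 ->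
  monomial n l s (pre ++ [:: k1, k2 & post]) = 
  \pi_(semi_wedge n l s)
    (exchange_rhs n l (fun c d => << pre ++ [:: c, d & post] >>) k1 k2).
Proof. by move=> k12; apply/pi_wedge_rel/Exchange. Qed.

Lemma exchange_rhs_diag (V : lmodType Qq) (w : int -> int -> V) k :
  exchange_rhs n l w k k = - w k k.
Proof. by rewrite /exchange_rhs /res_a /res_b !subrr mulr0 mod0z. Qed.

(** In this case the relation reads [v = - v]: no ordered monomial lies between
two equal entries. *)
Lemma monomial_adjacent_eq (pre post : seq int) (k : int) :
  monomial n l s (pre ++ [:: k, k & post]) = 0.
Proof.
have := exchange pre post (lexx k); rewrite exchange_rhs_diag.
rewrite -scaleN1r pi_wedgeZ scaleN1r -/(monomial n l s _) => /eqP.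
rewrite -addr_eq0 -mulr2n -scaler_nat scaler_eq0 => /orP[|/eqP//].
rewrite -(rmorph_nat (@FracField.tofrac {poly rat})) tofrac_eq0.
by rewrite -polyC_natr polyC_eq0.
Qed.

(** * Straightening *)

Definition same_content (ks ks' : seq int) : bool :=
  perm_eq (map (idx_a n) ks) (map (idx_a n) ks') &&
  perm_eq (map (idx_b n l) ks) (map (idx_b n l) ks').

Lemma idx_of_eq k a b m : 1 <= a <= n%:Z -> 1 <= b <= l%:Z ->
  k = idx_of n l a b m -> idx_a n k = a /\ idx_b n l k = b.
Proof. by move=> a1 b1 ->; have [-> ->] := idx_ofK m a1 b1. Qed.

Lemma ord_sum_span (V : lmodType Qq) (w : int -> int -> V) (S : V -> Prop)
    m0 x c d :
  (forall m, (m0 <= m)%N ->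
     d + (n * l * m)%N%:Z < c - (n * l * m)%N%:Z ->
     in_span S (w (c - (n * l * m)%N%:Z) (d + (n * l * m)%N%:Z))) ->
  in_span S (ord_sum n l w m0 x c d).
Proof.
move=> wS; rewrite /ord_sum big_nat_cond; apply: in_span_sum => m.
by case/andP=> /andP[m0m _] lt_dc; apply/in_spanZ/wS.
Qed.

(** Each family of monomials on the right of an exchange relation arises from
[k2, k1] by swapping the [a]'s (shift by alpha), the [b]'s (shift by beta),
both (shift by alpha + beta - nl) or neither, and by moving a multiple of nl
from the left entry to the right one; the left entry never exceeds [k2]. *)
Lemma exchange_rhs_span (V : lmodType Qq) (w : int -> int -> V) (S : V -> Prop)
    k1 k2 : k1 < k2 ->
  (forall c d, [/\ d < c, c <= k2, c + d = k1 + k2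
                 & same_content [:: c; d] [:: k1; k2]] -> in_span S (w c d)) ->
  in_span S (exchange_rhs n l w k1 k2).
Proof.
move=> k12 wS.
have [a1P b1P E1] := idx_of_surj k1 n_gt0 l_gt0.
have [a2P b2P E2] := idx_of_surj k2 n_gt0 l_gt0.
have nl0 : (n * l)%N%:Z != 0 by lia.
have := modz_ge0 (idx_a n k2 - idx_a n k1) nl0.
have := modz_ge0 (n%:Z * (idx_b n l k2 - idx_b n l k1)) nl0.
have := divz_eq (idx_a n k2 - idx_a n k1) (n * l)%N.
have := divz_eq (n%:Z * (idx_b n l k2 - idx_b n l k1)) (n * l)%N.
rewrite -/(res_a n l k1 k2) -/(res_b n l k1 k2).
set ea := (_ %/ _)%Z; set eb := (_ %/ _)%Z.
rewrite /exchange_rhs.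
move: (res_a n l k1 k2) (res_b n l k1 k2) ea eb => al be eb ea Eb Ea be0 al0.
have wS' a b m a' b' m' c d : 1 <= a <= n%:Z -> 1 <= b <= l%:Z ->
    1 <= a' <= n%:Z -> 1 <= b' <= l%:Z ->
    c = idx_of n l a b m -> d = idx_of n l a' b' m' ->
    perm_eq [:: a; a'] [:: idx_a n k1; idx_a n k2] ->
    perm_eq [:: b; b'] [:: idx_b n l k1; idx_b n l k2] ->
    d < c -> c <= k2 -> c + d = k1 + k2 -> in_span S (w c d).
  move=> aP bP a'P b'P cE dE paa pbb dc ck cd; apply: wS; split=> //.
  have [ca cb] := idx_of_eq aP bP cE; have [da db] := idx_of_eq a'P b'P dE.
  by rewrite /same_content /= ca cb da db paa.
have swap (x y : int) : perm_eq [:: y; x] [:: x; y].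
  by rewrite (perm_catC [:: y] [:: x]).
have w21 : in_span S (w k2 k1).
  apply: (wS' _ _ _ _ _ _ _ _ a2P b2P a1P b1P (esym E2) (esym E1)) => //.
  exact: addrC.
have alE : al = idx_a n k2 - idx_a n k1 - ea * (n * l)%N%:Z.
  by rewrite Ea addrC addKr.
have beE : be = n%:Z * (idx_b n l k2 - idx_b n l k1) - eb * (n * l)%N%:Z.
  by rewrite Eb addrC addKr.
clear Ea Eb nl0.
have o21 x : in_span S (ord_sum n l w 1 x k2 k1).
  apply: ord_sum_span => m m_ge lt_dc.
  have nlm : (n * l * 1 <= n * l * m)%N by apply: leq_mul.
  apply: (wS' _ _ (idx_m n l k2 + m%:Z) _ _
    (idx_m n l k1 - (m%:Z)) _ _ a2P b2P a1P b1P _ _ _ _ lt_dc) => //.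
  - by rewrite -[in LHS]E2 /idx_of !PoszM; ring.
  - by rewrite -[in LHS]E1 /idx_of !PoszM; ring.
  - by move: nlm al0 be0; clear; lia.
  - by clear; ring.
have oal x : in_span S (ord_sum n l w 0 x (k2 - al) (k1 + al)).
  apply: ord_sum_span => m m_ge lt_dc.
  apply: (wS' _ _ (idx_m n l k2 + (m%:Z - ea)) _ _
    (idx_m n l k1 - (m%:Z - ea)) _ _ a1P b2P a2P b1P _ _ _ _ lt_dc) => //.
  - by rewrite -[in LHS]E2 alE /idx_of !PoszM; ring.
  - by rewrite -[in LHS]E1 alE /idx_of !PoszM; ring.
  - by move: al0 be0; clear; lia.
  - by clear; ring.
have obe x : in_span S (ord_sum n l w 0 x (k2 - be) (k1 + be)).
  apply: ord_sum_span => m m_ge lt_dc.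
  apply: (wS' _ _ (idx_m n l k2 + (m%:Z - eb)) _ _
    (idx_m n l k1 - (m%:Z - eb)) _ _ a2P b1P a1P b2P _ _ _ _ lt_dc) => //.
  - by rewrite -[in LHS]E2 beE /idx_of !PoszM; ring.
  - by rewrite -[in LHS]E1 beE /idx_of !PoszM; ring.
  - by move: al0 be0; clear; lia.
  - by clear; ring.
have oab x : in_span S (ord_sum n l w 1 x (k2 + (n * l)%N%:Z - al - be)
    (k1 - (n * l)%N%:Z + al + be)).
  apply: ord_sum_span => m m_ge lt_dc.
  have nlm : (n * l * 1 <= n * l * m)%N by apply: leq_mul.
  apply: (wS' _ _ (idx_m n l k2 + (m%:Z - ea - eb - 1)) _ _
    (idx_m n l k1 - (m%:Z - ea - eb - 1)) _ _ a1P b1P a2P b2P _ _ _ _ lt_dc) => //.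
  - by rewrite -[in LHS]E2 alE beE /idx_of !PoszM; ring.
  - by rewrite -[in LHS]E1 alE beE /idx_of !PoszM; ring.
  - by move: nlm al0 be0; clear; lia.
  - by clear; ring.
case: ifP => _; first exact: in_spanN.
by case: ifP => _; [|case: ifP => _];
  repeat first [apply: in_spanD | apply: in_spanZ | apply: in_spanN
               |rewrite scaleNr].
Qed.

Definition straightened (x : int) (ks ks' : seq int) : Prop :=
  [/\ sorted (fun c d => d < c) ks', all (>= x) ks',
      \sum_(k <- ks') k = \sum_(k <- ks) k & same_content ks' ks].

Lemma same_content_cat pre ks ks' post :
  same_content ks ks' -> same_content (pre ++ ks ++ post) (pre ++ ks' ++ post).
Proof.
by move=> /andP[pa pb]; rewrite /same_content !map_cat !perm_cat2l !perm_cat2r pa.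
Qed.

Lemma same_content_trans : transitive same_content.
Proof.
move=> k2 k1 k3 /andP[a12 b12] /andP[a23 b23].
by rewrite /same_content (perm_trans a12 a23) (perm_trans b12).
Qed.

Lemma same_content_size ks ks' : same_content ks ks' -> size ks = size ks'.
Proof. by move=> /andP[/perm_size]; rewrite !size_map. Qed.

Lemma not_decreasing (ks : seq int) :
  ~~ sorted (fun c d => d < c) ks ->
  exists pre k1 k2 post, k1 <= k2 /\ ks = pre ++ [:: k1, k2 & post].
Proof.
elim: ks => // k1 [|k2 post] IH //=; rewrite negb_and -leNgt => /orP[k12|nsort].
  by exists [::], k1, k2, post.
have [pre [c [d [post' [cd ->]]]]] := IH nsort.
by exists (k1 :: pre), c, d, post'.
Qed.

(** The sum over the entries [y] of their position times their distance to [x].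
An exchange turns [k1 <= k2] into [c > d] with the same sum and [d < k2], so it
moves weight to the left and this number drops. *)
Fixpoint disorder (x : int) (ks : seq int) : nat :=
  if ks is k :: ks' then (disorder x ks' + \sum_(y <- ks') `|y - x|)%N else 0%N.

Lemma disorder_cat x pre ks ks' :
  (\sum_(y <- ks) `|y - x| = \sum_(y <- ks') `|y - x|)%N ->
  (disorder x ks < disorder x ks')%N ->
  (disorder x (pre ++ ks) < disorder x (pre ++ ks'))%N.
Proof.
move=> eq_sum lt_dis; elim: pre => //= k pre IH.
by rewrite !big_cat /= eq_sum ltn_add2r.
Qed.

(** The bound [x] makes the rewriting terminate, as no exchange produces an entry
below the smaller entry of the pair. *)
Lemma straighten x ks : all (>= x) ks ->
  in_span (fun v => exists2 ks', straightened x ks ks' & v = monomial n l s ks')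
          (monomial n l s ks).
Proof.
have [N] := ubnP (disorder x ks); elim: N => // N IH in ks *.
rewrite ltnS => dis_ks ge_ks; have [dec|] := boolP (sorted (fun c d => d < c) ks).
  by apply: in_span_gen; exists ks => //; split; rewrite // /same_content !perm_refl.
case/not_decreasing=> pre [k1 [k2 [post [k12 def_ks]]]].
move: k12; rewrite le_eqVlt => /predU1P[k12|k12].
  by rewrite def_ks k12 monomial_adjacent_eq; apply: in_span0.
move: ge_ks dis_ks; rewrite {}def_ks => ge_ks dis_ks; rewrite exchange ?ltW //.
set T := fun v : semi_wedge n l s => _.
have : in_span (fun v => in_span T (\pi_(semi_wedge n l s) v))
    (exchange_rhs n l (fun c d => << pre ++ [:: c, d & post] >>) k1 k2).
  apply: exchange_rhs_span => // c d [dc ck cd cont]; apply: in_span_gen.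
  move: ge_ks; rewrite all_cat /= => /and4P[ge_pre ge_k1 ge_k2 ge_post].
  have ge_c : x <= c by lia.
  have ge_d : x <= d by lia.
  have eq_sum : (`|c - x| + `|d - x| = `|k1 - x| + `|k2 - x|)%N by lia.
  apply: in_span_sub (IH (pre ++ [:: c, d & post]) _ _).
  - move=> _ [ks' [dec' ge' sum' cont'] ->]; apply: in_span_gen; exists ks' => //.
    split=> //.
      by rewrite sum' !big_cat !big_cons /= ![_ + (_ + \sum_(k <- post) _)]addrA cd.
    apply: same_content_trans cont' _.
    exact: (@same_content_cat pre [:: c; d] [:: k1; k2] post cont).
  - apply: leq_trans dis_ks; apply: disorder_cat.
      by rewrite !big_cons !addnA eq_sum.
    rewrite /= !big_cons -!addnA !ltn_add2l ltn_add2r.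
    by move: ge_d ge_k2 ge_c ge_k1 cd ck dc; clear; lia.
  - by rewrite all_cat /= ge_pre ge_c ge_d.
case=> cs [Scs ->]; rewrite pi_wedge_sum big_seq; apply: in_span_sum => y /Scs.
by rewrite pi_wedgeZ; apply: in_spanZ.
Qed.

(** * Vanishing of words with a small sum *)

Lemma head_decreasing_ge (x k : int) ks :
  sorted (fun c d => d < c) (k :: ks) -> all (>= x) (k :: ks) ->
  x + (size ks)%:Z <= k.
Proof.
elim: ks k => [|k' ks IH] k /=; first by rewrite addr0 andbT.
move=> /andP[lt_k dec] /andP[_ ge_ks].
by have /= := IH k' dec ge_ks; move: lt_k; clear; lia.
Qed.

Lemma sum_decreasing_ge (x : int) ks : sorted (fun c d => d < c) ks ->
  all (>= x) ks -> \sum_(0 <= i < size ks) (x + i%:Z) <= \sum_(k <- ks) k.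
Proof.
elim: ks => [|k ks IH] dec ge_ks; first by rewrite !big_nil.
rewrite [leRHS]big_cons big_nat_recr //= addrC.
apply: lerD (head_decreasing_ge dec ge_ks) (IH (path_sorted dec) _).
by case/andP: ge_ks.
Qed.

(** Straightening keeps the sum, the length and the lower bound, and the least sum
of a strictly decreasing word with entries at least [x] is that of the
progression x, x + 1, ... *)
Lemma monomial_low_sum x ks : all (>= x) ks ->
  \sum_(k <- ks) k < \sum_(0 <= i < size ks) (x + i%:Z) -> monomial n l s ks = 0.
Proof.
move=> ge_ks low; have [cs [Scs ->]] := straighten ge_ks.
rewrite big_seq big1 // => c /Scs[ks' [dec ge_ks' sum_ks' cont] _].
have := sum_decreasing_ge dec ge_ks'.
by rewrite sum_ks' (same_content_size cont) leNgt low.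
Qed.
Lemma entry_mkseq F r i :
  entry s (mkseq F r) i = if (i < r)%N then F i else s - i%:Z.
Proof. by rewrite /entry size_mkseq; case: ifP => // ir; rewrite nth_mkseq. Qed.

Lemma big_mkseq_int (F : nat -> int) r :
  \sum_(k <- mkseq F r) k = \sum_(0 <= i < r) F i.
Proof. by rewrite big_map /index_iota subn0. Qed.

Lemma big_nat_truncate (V : nmodType) (F : nat -> V) a b : (a <= b)%N ->
  (forall p, (a <= p)%N -> F p = 0) ->
  \sum_(0 <= p < b) F p = \sum_(0 <= p < a) F p.
Proof.
move=> ab F0; rewrite (big_cat_nat (n := a)) //= [X in _ + X]big_nat_cond.
by rewrite [X in _ + X]big1 ?addr0 // => p /andP[/andP[/F0]].
Qed.

Lemma degreeE k r : (size k <= r)%N ->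
  degree s k = \sum_(0 <= i < r) (entry s k i - (s - i%:Z)).
Proof.
move=> kr; apply/esym/big_nat_truncate => // p kp.
by rewrite /entry ltnNge kp subrr.
Qed.

(** The slack [h] leaves room for an operator to raise the degree by [h]: the
first [r] factors may then be reversed before and after it acts. *)
Definition fits (h : int) (r : nat) (k : seq int) : Prop :=
  [/\ size k = r, forall i, (i < r)%N -> s - r%:Z < entry s k i
    & degree s k + h <= r%:Z].

Lemma fits_bar_length h r k : 0 <= h -> fits h r k -> bar_length s r k.
Proof.
move=> h0 [kr gt_k deg_k]; split=> // [|i ri]; first by lia.
by rewrite /entry kr ltnNge ri.
Qed.

Lemma fits_exists h k :
  exists r, (size k <= r)%N /\ fits h r (mkseq (entry s k) r).
Proof.
have [r [kr Mr hr]] : exists r, [/\ (size k <= r)%N,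
    (\sum_(y <- k) `|(s - y)%R| < r)%N & degree s k + h <= r%:Z].
  exists (size k + \sum_(y <- k) `|(s - y)%R| + `|(degree s k + h)%R|).+1.
  by move: (degree s k + h) (bigop _ _ _) => d M; split; clear; lia.
have padE i : entry s (mkseq (entry s k) r) i = entry s k i.
  rewrite entry_mkseq; case: ltnP => // ri.
  by rewrite /entry ltnNge (leq_trans kr ri).
exists r; split=> //; split; first by rewrite size_mkseq.
- move=> i ir; rewrite padE /entry; case: ifP => ik; last by lia.
  have : (`|(s - nth 0 k i)%R| < r)%N.
    apply: leq_ltn_trans Mr.
    by rewrite (big_nth 0) big_mkord (bigD1 (Ordinal ik)) //= leq_addr.
  by move: (nth 0 k i) => y; clear; lia.
- have -> // : degree s (mkseq (entry s k) r) = degree s k.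
  rewrite (degreeE (r := r)) ?size_mkseq // [RHS](degreeE kr).
  by apply: eq_bigr => i _; rewrite padE.
Qed.

(** A strictly decreasing word of [p + 1] entries, all at least s - p + 1, has sum
at least (s - p + 1) + ... + (s + 1); the bound on the degree puts the raised
word below this. *)
Lemma replace_factor_vacuum k p y : (size k <= p)%N ->
  (forall i, (i < p)%N -> s - p%:Z < entry s k i) -> s - p%:Z < y ->
  degree s k + (y - (s - p%:Z)) <= p%:Z -> replace_factor n l s k p y = 0.
Proof.
move=> kp gt_k gt_y deg_k; rewrite /replace_factor (maxn_idPr _); last by lia.
apply: (@monomial_low_sum (s - p%:Z + 1)).
  apply/allP => z /mapP[i]; rewrite mem_iota add0n => ip ->.
  case: eqP => [_|/eqP ni]; first by move: gt_y; clear; lia.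
  by have := gt_k i ltac:(lia); clear; lia.
rewrite size_mkseq big_mkseq_int big_nat_recr //= eqxx.
have -> : \sum_(0 <= i < p) (if i == p then y else entry s k i) =
          degree s k + \sum_(0 <= i < p) (s - i%:Z).
  rewrite (degreeE kp) -big_split; apply: eq_big_nat => i /andP[_ ip] /=.
  by rewrite subrK ltn_eqF.
have -> : \sum_(0 <= i < p.+1) (s - p%:Z + 1 + i%:Z) =
          s + 1 + \sum_(0 <= i < p) (s - i%:Z).
  rewrite big_nat_rev big_nat_recl //=; congr (_ + _); first by clear; lia.
  by apply: eq_big_nat => i /andP[_ ip]; lia.
by move: (bigop _ _ _) deg_k => S; clear; lia.
Qed.

(** The summand of [bar_exponent]. *)
Definition coincidence (x y : int) : int :=
  (idx_b n l x == idx_b n l y)%:Z - (idx_a n x == idx_a n y)%:Z.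

Lemma coincidenceC x y : coincidence x y = coincidence y x.
Proof. by rewrite /coincidence eq_sym [in X in _ - X]eq_sym. Qed.

(** * Operators acting on one factor at a time *)

Section BarInvolution.
Variables (bar : semi_wedge n l s -> semi_wedge n l s).
Hypothesis bar_inv : is_bar_involution bar.

Lemma bar0 : bar 0 = 0.
Proof.
have /eqP := (proj1 bar_inv) 1 0 0; rewrite qbar1 !scale1r addr0.
by rewrite -subr_eq0 opprD addrA subrr sub0r oppr_eq0 => /eqP.
Qed.

Lemma barZ c v : bar (c *: v) = qbar c *: bar v.
Proof. by rewrite -[c *: v]addr0 (proj1 bar_inv) [X in _ + X]bar0 addr0. Qed.

Lemma barD u v : bar (u + v) = bar u + bar v.
Proof. by have := (proj1 bar_inv) 1 u v; rewrite qbar1 !scale1r. Qed.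

Lemma bar_sum (I : Type) (r : seq I) (F : I -> semi_wedge n l s) :
  bar (\sum_(i <- r) F i) = \sum_(i <- r) bar (F i).
Proof. exact: (big_morph _ barD bar0). Qed.

End BarInvolution.

Section FactorwiseOperator.
Variables (P : pred int) (g om : int -> int) (h : int).
Variables (T : {linear semi_wedge n l s -> semi_wedge n l s}).
Variables (bar : semi_wedge n l s -> semi_wedge n l s).
Hypothesis raises : forall x, P x -> x < g x <= x + h.
Hypothesis coincidence_raised :
  forall x y, P x -> coincidence (g x) y = coincidence x y + om y.

Definition factor_term k p : semi_wedge n l s :=
  if P (entry s k p) then
    q ^ (\sum_(0 <= j < p) om (entry s k j))
      *: replace_factor n l s k p (g (entry s k p))
  else 0.

Hypothesis T_monomial :
  forall k, is_finite_sum (factor_term k) (T (monomial n l s k)).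
Hypothesis bar_inv : is_bar_involution bar.

(** Raising a factor of the vacuum tail gives zero when the tail starts far enough
to the right. *)
Lemma factorwise_truncate r k : fits h r k ->
  T (monomial n l s k) = \sum_(0 <= p < r) factor_term k p.
Proof.
move=> [kr gt_k deg_k]; have [N [N0 ->]] := T_monomial k.
have r0 p : (r <= p)%N -> factor_term k p = 0.
  move=> rp; rewrite /factor_term; case: ifP => // Pp.
  have := raises Pp; have -> : entry s k p = s - p%:Z.
    by rewrite /entry kr ltnNge rp.
  move=> up; rewrite replace_factor_vacuum ?scaler0 ?kr //; last 2 first.
  - by case/andP: up.
  - by move: up deg_k; lia.
  move=> i ip; have [ir|ri] := ltnP i r; first by have := gt_k i ir; lia.
  by rewrite /entry kr ltnNge ri /=; lia.
rewrite -(big_nat_truncate (leq_maxl N r)) //.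
by rewrite (big_nat_truncate (leq_maxr N r)).
Qed.

Lemma bar_exponentE r k : bar_exponent n l s r k =
  \sum_(0 <= j < r) \sum_(0 <= i < j) coincidence (entry s k i) (entry s k j).
Proof. by []. Qed.

(** Only the pairs containing the raised factor change, and each of them
contributes the weight of its other member. *)
Lemma bar_exponent_raised r p k k' : (p < r)%N -> P (entry s k p) ->
  (forall i, entry s k' i = if i == p then g (entry s k p) else entry s k i) ->
  bar_exponent n l s r k' = bar_exponent n l s r k
    + \sum_(0 <= j < p) om (entry s k j) + \sum_(p.+1 <= j < r) om (entry s k j).
Proof.
move=> pr Pp k'E; rewrite !bar_exponentE.
rewrite !(big_cat_nat (n := p.+1) (m := 0%N) (p := r)) //= !(big_nat_recr p) //=.
pose c i j := coincidence (entry s k i) (entry s k j).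
pose c' i j := coincidence (entry s k' i) (entry s k' j).
have lowE : \sum_(0 <= j < p) \sum_(0 <= i < j) c' i j =
            \sum_(0 <= j < p) \sum_(0 <= i < j) c i j.
  apply: eq_big_nat => j /andP[_ jp]; apply: eq_big_nat => i /andP[_ ij].
  by rewrite /c' /c !k'E !ltn_eqF // (ltn_trans ij).
have midE : \sum_(0 <= i < p) c' i p =
    \sum_(0 <= i < p) c i p + \sum_(0 <= i < p) om (entry s k i).
  rewrite -big_split; apply: eq_big_nat => i /andP[_ ip] /=.
  rewrite /c' /c !k'E eqxx ltn_eqF // coincidenceC coincidence_raised //.
  by rewrite coincidenceC.
have highE : \sum_(p.+1 <= j < r) \sum_(0 <= i < j) c' i j =
    \sum_(p.+1 <= j < r) \sum_(0 <= i < j) c i j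
    + \sum_(p.+1 <= j < r) om (entry s k j).
  rewrite -big_split; apply: eq_big_nat => j /andP[pj _] /=.
  rewrite (big_cat_nat (n := p)) ?(ltnW pj) //=.
  rewrite [in RHS](big_cat_nat (n := p)) ?(ltnW pj) //=.
  rewrite (big_ltn pj) [in RHS](big_ltn pj).
  have out i : (i != p)%N -> c' i j = c i j.
    by move=> ip; rewrite /c' /c !k'E (negPf ip) gtn_eqF.
  rewrite -[RHS]addrA; congr (_ + _).
    by apply: eq_big_nat => i /andP[_ ip]; rewrite out // ltn_eqF.
  rewrite [RHS]addrAC; congr (_ + _).
    by rewrite /c' /c !k'E eqxx gtn_eqF // coincidence_raised.
  by apply: eq_big_nat => i /andP[pi _]; rewrite out // gtn_eqF.
by rewrite lowE midE highE /c; ring.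
Qed.

(** The term raising factor [p] before the reversal corresponds to the one raising
factor [r - p.+1] after it, whose left weights are the right weights of the
former. *)
Lemma bar_factorwise_monomial k :
  bar (T (monomial n l s k)) = T (bar (monomial n l s k)).
Proof.
have [r [kr]] := fits_exists (Num.max h 0) k; rewrite -(monomial_pad kr).
move: (mkseq _ _) => {kr}k fit0.
have h0 : 0 <= Num.max h 0 by rewrite le_max lexx orbT.
have fit : fits h r k.
  case: fit0 => kr gt_k deg_k; split=> //.
  by apply: le_trans deg_k; rewrite lerD2l le_max lexx.
have [_ bar_mon] := bar_inv; rewrite (bar_mon _ r (fits_bar_length h0 fit0)).
have [kr gt_k deg_k] := fit.
pose k' := rev (mkseq (entry s k) r).
have k'E i : (i < r)%N -> entry s k' i = entry s k (r - i.+1).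
  move=> ir; rewrite /entry size_rev size_mkseq ir nth_rev size_mkseq //.
  by rewrite nth_mkseq ?rev_ord_proof //; lia.
have k'r : size k' = r by rewrite size_rev size_mkseq.
have fit' : fits h r k'.
  split=> // [i ir|]; first by rewrite k'E // gt_k //; lia.
  apply: le_trans deg_k; rewrite lerD2r le_eqVlt; apply/orP; left; apply/eqP.
  rewrite (degreeE (r := r)) ?k'r // [RHS](degreeE (r := r)) ?kr //.
  rewrite !sumrB; congr (_ - _); rewrite [RHS]big_nat_rev; apply: eq_big_nat.
  by move=> i /andP[_ ir]; rewrite k'E.
rewrite linearZ /= (factorwise_truncate fit) (factorwise_truncate fit').
rewrite (bar_sum bar_inv) scaler_sumr.
rewrite [RHS]big_nat_rev; apply: eq_big_nat => p /andP[_ pr] /=.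
have pr' : (r - p.+1 < r)%N by lia.
have ppE : (r - (r - p.+1).+1 = p)%N by lia.
rewrite add0n /factor_term k'E //.
rewrite ppE; have [Pp|_] := boolP (P (entry s k p)); last first.
  by rewrite scaler0 (bar0 bar_inv).
set y := g _.
pose kp := mkseq (fun i => if i == p then y else entry s k i) (maxn (size k) p.+1).
have kpr : size kp = r by rewrite size_mkseq kr; apply/maxn_idPl.
have kpE i : entry s kp i = if i == p then y else entry s k i.
  rewrite entry_mkseq kr (maxn_idPl pr); case: ltnP => // ri.
  by rewrite gtn_eqF ?(leq_trans pr) // /entry kr ltnNge ri.
have y_up := raises Pp.
have fitp : bar_length s r kp.
  apply: (fits_bar_length (lexx 0)); split=> // [i ir|].
    rewrite kpE; case: eqP => _; last exact: gt_k.
    by rewrite /y; have := gt_k p pr; move: y_up; clear; lia.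
  apply: le_trans deg_k; rewrite addr0.
  rewrite (degreeE (r := r)) ?kpr // [in leRHS](degreeE (r := r)) ?kr //.
  rewrite !sumrB addrAC lerD2r big_mkord (bigD1 (Ordinal pr)) //=.
  rewrite [in leRHS]big_mkord [in leRHS](bigD1 (Ordinal pr)) //= kpE eqxx.
  rewrite [leRHS]addrAC lerD //; first by case/andP: y_up.
  by apply: ler_sum => i; rewrite kpE -val_eqE /= => /negPf->.
rewrite (barZ bar_inv) qbarXz [replace_factor _ _ _ k p y]/(monomial n l s kp).
rewrite (bar_mon _ r fitp) (bar_exponent_raised pr Pp kpE) !scalerA.
have -> : \sum_(0 <= j < r - p.+1) om (entry s k' j) =
          \sum_(p.+1 <= j < r) om (entry s k j).
  rewrite [RHS]big_nat_rev -{2}[p.+1]add0n big_addn.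
  apply: eq_big_nat => j /andP[_ jr].
  by rewrite k'E; [congr (om (entry _ _ _)); lia | lia].
congr (_ *: _).
  rewrite !expfzDr ?q_neq0 // mulrCA -!mulrA; congr (_ * _).
  rewrite mulrCA; congr (_ * _); rewrite mulrA -expfzDr ?q_neq0 //.
  by rewrite addNr expr0z mul1r.
congr monomial; apply: (@eq_from_nth _ 0).
  by rewrite size_rev !size_mkseq k'r; lia.
rewrite size_rev size_mkseq => i ir.
rewrite nth_rev size_mkseq // !nth_mkseq ?kpE ?k'r; [|lia|lia].
by rewrite k'E //; have -> : (r - i.+1 == p)%N = (i == r - p.+1)%N by lia.
Qed.

Lemma bar_factorwise v : bar (T v) = T (bar v).
Proof.
have [cs [cs_mon ->]] := in_span_monomial v.
rewrite raddf_sum !(bar_sum bar_inv) raddf_sum big_seq [RHS]big_seq.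
apply: eq_bigr => -[c u] /cs_mon[k /= ->].
rewrite linearZZ [LHS](barZ bar_inv) [in RHS](barZ bar_inv) [RHS]linearZZ.
by rewrite bar_factorwise_monomial.
Qed.

End FactorwiseOperator.
(** * The lowering and Heisenberg operators *)

Lemma eq_mod_range (N : nat) (a c : int) : 1 <= a <= N%:Z -> 1 <= c <= N%:Z ->
  (a == c %[mod N])%Z = (a == c).
Proof.
move=> a_rng c_rng; rewrite eqz_mod_dvd; apply/idP/eqP => [|->]; last first.
  by rewrite subrr dvdz0.
case/dvdzP=> t ac; have : t = 0.
  apply/eqP; rewrite -[_ == _]negbK; apply/negP => t0.
  have : `|t * N%:Z| < N%:Z by rewrite -ac; lia.
  rewrite normrM; have : 1 <= `|t| by lia.
  by move: (`|t|) => u; nia.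
by move=> t0; move: ac; rewrite t0 mul0r => /eqP; rewrite subr_eq0 => /eqP.
Qed.

(** The wrap of [a] from n to 1 occurs for i = 0 alone; the drop of [m] by 1 that
goes with it turns the change of the index into nl - n + 1. *)
Lemma lower_aE i x : (i < n)%N -> (i == idx_a n x %[mod n])%Z ->
  [/\ x < lower_a n l i x <= x + (n * l)%N%:Z,
      idx_b n l (lower_a n l i x) = idx_b n l x
    & (idx_a n (lower_a n l i x) == i.+1 %[mod n])%Z].
Proof.
move=> i_n ia; have [aP bP xE] := idx_of_surj x n_gt0 l_gt0.
have a'P : 1 <= (if idx_a n x == n%:Z then 1 else idx_a n x + 1) <= n%:Z.
  by move: aP; case: eqP; lia.
rewrite /lower_a; have [-> -> _] := idx_ofK (idx_m n l x - (i == 0)%N%:Z) a'P bP.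
have [ia_n|ia_n] := eqVneq (idx_a n x) n%:Z.
  have i0 : i = 0%N.
    by move: ia; rewrite ia_n modzz modz_small; [move/eqP => -[]|lia].
  split=> //; last by rewrite i0.
  have -> : idx_of n l 1 (idx_b n l x) (idx_m n l x - (i == 0)%N%:Z) =
      x + 1 - n%:Z + (n * l)%N%:Z.
    by rewrite -[in RHS]xE ia_n i0 /idx_of eqxx /=; ring.
  have : (n <= n * l)%N by apply: leq_pmulr.
  by move: n_gt0; move: (n * l)%N => N; clear; lia.
have i_a : i%:Z = idx_a n x.
  by move: ia; rewrite !modz_small; [move/eqP | lia | lia].
split=> //; last by rewrite intS -i_a addrC.
have -> : idx_of n l (idx_a n x + 1) (idx_b n l x)
                 (idx_m n l x - (i == 0)%N%:Z) = x + 1.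
  have -> : (i == 0)%N = false.
    by apply/negP => /eqP i0; move: i_a aP; rewrite i0; lia.
  by rewrite -[in RHS]xE /idx_of /=; ring.
have : (0 < n * l)%N by rewrite muln_gt0 n_gt0.
by move: (n * l)%N => N; clear; lia.
Qed.

(** The wrap of [b] from l to 1 changes the index by n, like all the other steps,
thanks to the drop of [m]. *)
Lemma lower_bE j x : (j < l)%N -> (j == idx_b n l x %[mod l])%Z ->
  [/\ x < lower_b n l j x <= x + n%:Z,
      idx_a n (lower_b n l j x) = idx_a n x
    & (idx_b n l (lower_b n l j x) == j.+1 %[mod l])%Z].
Proof.
move=> j_l jb; have [aP bP xE] := idx_of_surj x n_gt0 l_gt0.
have b'P : 1 <= (if idx_b n l x == l%:Z then 1 else idx_b n l x + 1) <= l%:Z.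
  by move: bP; case: eqP; lia.
rewrite /lower_b; have [-> -> _] := idx_ofK (idx_m n l x - (j == 0)%N%:Z) aP b'P.
have [jb_l|jb_l] := eqVneq (idx_b n l x) l%:Z.
  have j0 : j = 0%N.
    by move: jb; rewrite jb_l modzz modz_small; [move/eqP => -[]|lia].
  split=> //; last by rewrite j0.
  have -> : idx_of n l (idx_a n x) 1 (idx_m n l x - (j == 0)%N%:Z) = x + n%:Z.
    by rewrite -[in RHS]xE jb_l j0 /idx_of eqxx PoszM /=; ring.
  by move: n_gt0; clear; lia.
have j_b : j%:Z = idx_b n l x.
  by move: jb; rewrite !modz_small; [move/eqP | lia | lia].
split=> //; last by rewrite intS -j_b addrC.
have -> : idx_of n l (idx_a n x) (idx_b n l x + 1)
                 (idx_m n l x - (j == 0)%N%:Z) = x + n%:Z.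
  have -> : (j == 0)%N = false.
    by apply/negP => /eqP j0; move: j_b bP; rewrite j0; lia.
  by rewrite -[in RHS]xE /idx_of /=; ring.
by move: n_gt0; clear; lia.
Qed.

Section Generators.
Variables (bar : semi_wedge n l s -> semi_wedge n l s).
Hypothesis bar_inv : is_bar_involution bar.

Lemma bar_lowering_a i (f : {linear semi_wedge n l s -> semi_wedge n l s}) :
  (i < n)%N -> is_lowering_a i f -> forall v, bar (f v) = f (bar v).
Proof.
move=> i_n f_low.
apply: (bar_factorwise (P := fun x => (i == idx_a n x %[mod n])%Z)
  (g := lower_a n l i) (om := wt_a n i) (h := (n * l)%N%:Z)
  _ _ f_low bar_inv) => [x|x y] ia.
  by case: (lower_aE i_n ia).
have [_ eq_b eq_a] := lower_aE i_n ia.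
have idx_aP z : 1 <= idx_a n z <= n%:Z by case: (idx_of_surj z n_gt0 l_gt0).
rewrite /coincidence eq_b -!(eq_mod_range (idx_aP _) (idx_aP y)) /wt_a.
by rewrite (eqP eq_a) (eqP ia); lia.
Qed.

Lemma bar_lowering_b j (f : {linear semi_wedge n l s -> semi_wedge n l s}) :
  (j < l)%N -> is_lowering_b j f -> forall v, bar (f v) = f (bar v).
Proof.
move=> j_l f_low.
have f_low' k : is_finite_sum (factor_term
    (fun x => j == idx_b n l x %[mod l])%Z (lower_b n l j)
    (fun x => - wt_b n l j x) k) (f (monomial n l s k)).
  have [N [N0 fN]] := f_low k; exists N; split=> [p /N0|].
    by rewrite /factor_term sumrN.
  by rewrite fN; apply: eq_bigr => p _; rewrite /factor_term sumrN.
apply: (bar_factorwise (h := n%:Z) _ _ f_low' bar_inv) => [x|x y] jb.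
  by case: (lower_bE j_l jb).
have [_ eq_a eq_b] := lower_bE j_l jb.
have idx_bP z : 1 <= idx_b n l z <= l%:Z by case: (idx_of_surj z n_gt0 l_gt0).
rewrite /coincidence eq_a -!(eq_mod_range (idx_bP _) (idx_bP y)) /wt_b.
by rewrite (eqP eq_b) (eqP jb); lia.
Qed.

Lemma idx_shift x (m : int) :
  idx_a n (x + (n * l)%N%:Z * m) = idx_a n x /\
  idx_b n l (x + (n * l)%N%:Z * m) = idx_b n l x.
Proof.
have [aP bP xE] := idx_of_surj x n_gt0 l_gt0.
apply: (idx_of_eq (m := idx_m n l x - m)) => //.
by rewrite -[in LHS]xE /idx_of /=; ring.
Qed.

Lemma bar_heisenberg (m : int)
    (f : {linear semi_wedge n l s -> semi_wedge n l s}) :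
  0 < m -> is_heisenberg (- m) f -> forall v, bar (f v) = f (bar v).
Proof.
move=> m0 f_low.
have f_low' k : is_finite_sum (factor_term xpredT
    (fun x => x + (n * l)%N%:Z * m) (fun=> 0) k) (f (monomial n l s k)).
  have [N [N0 fN]] := f_low k.
  have termE p :
      factor_term xpredT (fun x => x + (n * l)%N%:Z * m) (fun=> 0) k p =
      replace_factor n l s k p (entry s k p - (n * l)%N%:Z * - m).
    by rewrite /factor_term big1 // expr0z scale1r mulrN opprK.
  exists N; split=> [p /N0|]; first by rewrite termE.
  by rewrite fN; apply: eq_bigr => p _; rewrite termE.
apply: (bar_factorwise (h := (n * l)%N%:Z * m) _ _ f_low' bar_inv) => [x _|x y _].
  have nl0 : (0 < n * l)%N by rewrite muln_gt0 n_gt0.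
  by rewrite lexx andbT ltrDl mulr_gt0 //; move: (n * l)%N nl0; clear; lia.
by have [a_x b_x] := idx_shift x m; rewrite /coincidence a_x b_x addr0.
Qed.

End Generators.
(** * Charges *)

Section Charges.

Lemma is_charge_tail (X : int -> Prop) (M : int) (F : seq int) :
  sorted (fun c d => d < c) F -> all (> M) F ->
  (forall y, X y <-> y <= M \/ y \in F) -> is_charge X (M + (size F)%:Z).
Proof.
move=> dec gtM XE.
pose x i := if (i < size F)%N then nth 0 F i else M + (size F)%:Z - i%:Z.
exists x; split.
- move=> i; rewrite /x; case: (ltnP i.+1 (size F)) => iF.
    by rewrite (ltnW iF); apply: (sortedP 0 dec).
  case: (ltnP i (size F)) => iF'; last by clear; lia.
  have /(allP gtM) : nth 0 F i \in F by apply: mem_nth.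
  by move: iF iF'; clear; lia.
- move=> y; rewrite XE; split=> [[yM|yF]|[i <-]].
  + exists (size F + `|M - y|%N)%N; rewrite /x ltnNge leq_addr /=.
    by move: yM; clear; lia.
  + by exists (index y F); rewrite /x index_mem yF nth_index.
  rewrite /x; case: ltnP => iF; first by right; apply: mem_nth.
  by left; move: iF; clear; lia.
- by exists (size F) => i Fi; rewrite /x ltnNge Fi.
Qed.

(** Two strictly decreasing enumerations of the same set agree term by term. *)
Lemma is_charge_inj (X : int -> Prop) (c c' : int) :
  is_charge X c -> is_charge X c' -> c = c'.
Proof.
have anti (x : nat -> int) : (forall i, x i.+1 < x i) ->
    forall i j, (i < j)%N -> x j < x i.
  move=> dec i; elim=> // j IH; rewrite ltnS leq_eqVlt => /predU1P[->//|/IH].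
  exact/lt_trans/dec.
have le_first x y i : (forall j, (j < i)%N -> x j = y j) ->
    (forall i, x i.+1 < x i) -> (forall i, y i.+1 < y i) ->
    (forall z, (exists j, x j = z) -> exists j, y j = z) -> x i <= y i :> int.
  move=> eq_lt /anti dx /anti dy sub_xy.
  have [j yj] := sub_xy _ (ex_intro _ i erefl); rewrite -yj.
  have [/dy/ltW//|ij|->//] := ltngtP i j.
  by have := dx _ _ ij; rewrite (eq_lt j ij) yj ltxx.
move=> [x [dx Xx [N xN]]] [y [dy Xy [N' yN']]].
have sub_xy z (xz : exists j, x j = z) : exists j, y j = z.
  exact: (proj1 (Xy z)) (proj2 (Xx z) xz).
have sub_yx z (yz : exists j, y j = z) : exists j, x j = z.
  exact: (proj1 (Xx z)) (proj2 (Xy z) yz).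
have xy i : x i = y i.
  elim/ltn_ind: i => i IH; apply/eqP; rewrite eq_le.
  by rewrite (le_first x y) // (le_first y x) // => j /IH.
have := xy (maxn N N'); rewrite xN ?leq_maxl // yN' ?leq_maxr //.
exact: addIr.
Qed.

Lemma lower_set_of_increasing (u : int -> int) (M : int) :
  (forall y y', y < y' -> u y < u y') -> exists m, forall y, u y <= M <-> y <= m.
Proof.
move=> inc; have up y (d : nat) : u y + d%:Z <= u (y + d%:Z).
  elim: d => [|d IH]; first by rewrite !addr0.
  have := inc (y + d%:Z) (y + d.+1%:Z) ltac:(lia).
  by move: IH; move: (u (y + d%:Z)) (u (y + d.+1%:Z)) (u y); clear; lia.
pose y0 : int := - `|M - u 0|%N%:Z.
have uy0 : u y0 <= M.
  have := up y0 `|M - u 0|%N; rewrite {2}/y0 addNr.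
  by move: (u y0) (u 0); clear; lia.
have ex : exists d, u (y0 + d%:Z) <= M by exists 0%N; rewrite addr0.
have bound d : u (y0 + d%:Z) <= M -> (d <= `|M - u y0|)%N.
  move=> le_M; have := up y0 d; move: le_M uy0.
  by move: (u (y0 + _)) (u y0); clear; lia.
have [d dM d_max] := ex_maxnP ex bound.
exists (y0 + d%:Z) => y; split=> [yM|yd].
  rewrite leNgt; apply/negP => lt_y.
  have yE : y = y0 + `|y - y0|%N%:Z by move: lt_y; clear; lia.
  have := d_max `|y - y0|%N; rewrite -yE => /(_ yM).
  by move: lt_y; clear; lia.
move: yd; rewrite le_eqVlt => /predU1P[-> //|/inc/ltW le_y].
exact: le_trans le_y dM.
Qed.

(** The integers of colour [c] are listed in increasing order by [unpos], with
inverse [pos]; the colour will be [b] or [a]. *)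
Variables (col pos unpos : int -> int) (c : int).
Hypothesis col_unpos : forall y, col (unpos y) = c.
Hypothesis unposK : cancel unpos pos.
Hypothesis posK : forall k, col k = c -> unpos (pos k) = k.
Hypothesis unpos_inc : forall y y', y < y' -> unpos y < unpos y'.

Definition colour_positions (k : seq int) (y : int) : Prop :=
  exists i, let ki := entry s k i in col ki = c /\ y = pos ki.

(** [M] is the charge of the vacuum tail alone. *)
Lemma colour_charge (r : nat) : exists M : int, forall k,
  size k = r -> sorted (fun x y => y < x) k -> all (> (s - r%:Z)) k ->
  is_charge (colour_positions k) (M + (count_mem c (map col k))%:Z).
Proof.
have [M ME] := lower_set_of_increasing (s - r%:Z) unpos_inc.
have inc_le y y' : (unpos y < unpos y') = (y < y').
  have [/unpos_inc//|/unpos_inc/ltW|->] := ltgtP y y'; last by rewrite ltxx.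
  by rewrite leNgt => /negPf.
exists M => k kr dec gt_k.
pose F := [seq pos z | z <- k & col z == c].
have -> : count_mem c (map col k) = size F.
  by rewrite size_map size_filter count_map; apply: eq_count.
apply: is_charge_tail.
- rewrite sorted_map; have trans : transitive (fun x y : int => y < x).
    by move=> y x z xy yz; apply: lt_trans yz xy.
  have := sorted_filter trans (fun z => col z == c) dec.
  apply: sub_in_sorted (allss _) => x y; rewrite !mem_filter.
  by move=> /andP[/eqP cx _] /andP[/eqP cy _] yx /=; rewrite -inc_le !posK.
- apply/allP => _ /mapP[z + ->]; rewrite mem_filter => /andP[/eqP cz /(allP gt_k)].
  rewrite ltNge; apply: contraTT; rewrite negbK -leNgt => /ME.
  by rewrite posK // leNgt.
- move=> y; split=> [[i [ci ->]]|[yM|/mapP[z + ->]]].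
  + have [ik|ki] := ltnP i (size k); last first.
      left; apply/ME; rewrite posK // /entry ltnNge ki /=.
      by move: ki; rewrite kr; clear; lia.
    right; apply/map_f; rewrite mem_filter ci eqxx /entry ik.
    exact: mem_nth.
  + exists `|s - unpos y|%N; have /ME le_y := yM.
    have -> : entry s k `|s - unpos y|%N = unpos y.
      rewrite /entry kr ltnNge; have -> /= : (r <= `|s - unpos y|)%N.
        by move: (unpos y) le_y; clear; lia.
      by move: (unpos y) le_y; clear; lia.
    by rewrite /= col_unpos unposK.
  rewrite mem_filter => /andP[/eqP cz zk]; exists (index z k).
  by rewrite /entry index_mem zk nth_index.
Qed.

Lemma charge_same_colours k k' sc : size k = size k' ->
  sorted (fun x y => y < x) k -> sorted (fun x y => y < x) k' ->
  all (> (s - (size k)%:Z)) k -> all (> (s - (size k)%:Z)) k' ->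
  perm_eq (map col k) (map col k') ->
  is_charge (colour_positions k) sc -> is_charge (colour_positions k') sc.
Proof.
move=> kk' dec dec' gt_k gt_k' cols; have [M MC] := colour_charge (size k).
move=> /(is_charge_inj (MC k erefl dec gt_k)) <-.
by rewrite (permP cols); apply: MC.
Qed.

End Charges.

(** * Invariance of the Fock subspaces *)

Section FockSubspaces.
Variables (bar : semi_wedge n l s -> semi_wedge n l s).
Hypothesis bar_inv : is_bar_involution bar.

Definition decreasing_above (r : nat) (k : seq int) : Prop :=
  [/\ size k = r, sorted (fun x y => y < x) k & all (> (s - r%:Z)) k].

Lemma decreasing_above_ordered r k : decreasing_above r k -> ordered s k.
Proof.
move=> [kr dec gt_k] i; rewrite /entry kr.
case: (ltnP i.+1 r) => [ir|ri]; first by rewrite (ltnW ir) (sortedP 0 dec) ?kr.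
case: ltnP => ir; last by clear; lia.
have /(allP gt_k) : nth 0 k i \in k by rewrite mem_nth ?kr.
by apply: le_lt_trans; move: ri ir; clear; lia.
Qed.

Lemma ordered_decreasing_above r k : ordered s k -> bar_length s r k ->
  decreasing_above r (mkseq (entry s k) r).
Proof.
move=> ord_k [_ _ gt_k]; split; first exact: size_mkseq.
  apply/(sortedP 0) => i; rewrite size_mkseq => ir.
  by rewrite !nth_mkseq ?(ltnW ir).
by apply/allP => _ /mapP[i + ->]; rewrite mem_iota => ir; apply: gt_k.
Qed.

Variable Q : seq int -> Prop.
Hypothesis Q_entry : forall k k', entry s k =1 entry s k' -> Q k -> Q k'.
Hypothesis Q_content : forall r k k', decreasing_above r k ->
  decreasing_above r k' -> same_content k k' -> Q k -> Q k'.

(** The straightening of the reversed word has the content of the word itself, so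
any property of ordered monomials that depends on the content alone cuts out a
subspace stable under bar. *)
Lemma bar_stable v :
  in_span (fun u => exists k, [/\ ordered s k, Q k & u = monomial n l s k]) v ->
  in_span (fun u => exists k, [/\ ordered s k, Q k & u = monomial n l s k])
          (bar v).
Proof.
case=> cs [cs_gen ->]; rewrite (bar_sum bar_inv) big_seq.
apply: in_span_sum => -[c u] /cs_gen[k /= [ord_k Qk ->]] {u}.
rewrite (barZ bar_inv); apply: in_spanZ.
have len_k : bar_length s `|degree s k|%N k.
  by apply: ordered_bar_length => //; move: (degree s k); clear; lia.
move: (`|degree s k|%N) len_k => r len_k.
rewrite (proj2 bar_inv _ _ len_k); apply: in_spanZ.
have dec_k := ordered_decreasing_above ord_k len_k.
have {}Qk : Q (mkseq (entry s k) r).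
  apply: Q_entry Qk => i; rewrite entry_mkseq; case: ltnP => // ri.
  by case: len_k => _ ->.
move: (mkseq _ _) dec_k Qk => {ord_k len_k}k dec_k Qk.
have [kr _ gt_k] := dec_k.
have ge_k : all (>= (s - r%:Z + 1)) (rev k).
  by rewrite all_rev; apply: sub_all gt_k => x; lia.
apply: in_span_sub (straighten ge_k) => _ [k' [dec' ge_k' _ cont'] ->].
have cont : same_content k k'.
  by case/andP: cont' => ca cb; apply/andP; split; rewrite perm_sym;
    [apply: perm_trans ca _ | apply: perm_trans cb _]; rewrite map_rev perm_rev.
have dec_k' : decreasing_above r k'.
  split=> //; first by rewrite -(same_content_size cont).
  by apply: sub_all ge_k' => x; lia.
apply: in_span_gen; exists k'; split=> //.
  exact: decreasing_above_ordered dec_k'.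
exact: Q_content dec_k dec_k' cont Qk.
Qed.

End FockSubspaces.

Lemma is_charge_ext (X Y : int -> Prop) c : (forall y, X y <-> Y y) ->
  is_charge X c -> is_charge Y c.
Proof.
move=> XY [x [dec Xx lim]]; exists x; split=> // y.
by split=> [Yy|xy]; [apply/Xx/XY | apply/XY/Xx].
Qed.

Lemma bar_fock_l bar sl v : is_bar_involution bar ->
  @fock_l n l s sl v -> fock_l sl (bar v).
Proof.
move=> bar_inv; apply: (bar_stable bar_inv (Q := fun k => has_charges_l n s k sl)).
  move=> k k' kk' Qk b; apply: is_charge_ext (Qk b) => y.
  by split=> -[i]; rewrite (kk', esym (kk' i)) => ?; exists i.
move=> r k k' [kr dec gt_k] [k'r dec' gt_k'] /andP[_ cols] Qk b.
have bP : 1 <= b.+1%:Z <= l%:Z by have := ltn_ord b; lia.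
pose unpos (y : int) :=
  idx_of n l (((y - 1) %% n)%Z + 1) b.+1%:Z (- ((y - 1) %/ n)%Z).
have aP (y : int) : 1 <= ((y - 1) %% n)%Z + 1 <= n%:Z.
  have nz : n%:Z != 0 by lia.
  by have := modz_ge0 (y - 1) nz; have := ltz_mod (y - 1) nz; lia.
apply: (@charge_same_colours (idx_b n l)
   (fun z => idx_a n z - n%:Z * idx_m n l z) unpos b.+1%:Z
   _ _ _ _ k) => //; rewrite ?kr ?k'r //.
- by move=> y; have [] := idx_ofK (- ((y - 1) %/ n)%Z) (aP y) bP.
- move=> y; have [-> _ ->] := idx_ofK (- ((y - 1) %/ n)%Z) (aP y) bP.
  by have := divz_eq (y - 1) n; lia.
- move=> z zb; have [zaP _ zE] := idx_of_surj z n_gt0 l_gt0.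
  rewrite -[RHS]zE zb /unpos.
  have -> : idx_a n z - n%:Z * idx_m n l z - 1 =
            - idx_m n l z * n%:Z + (idx_a n z - 1).
    by ring.
  have nz : n%:Z != 0 by lia.
  rewrite modzMDl divzMDl // modz_small ?divz_small; [|lia|lia].
  by rewrite subrK addr0 opprK.
- move=> y y' yy'.
  (* A sum of increasing and nondecreasing functions of [z]. *)
  have lE : l%:Z = l.-1%:Z + 1 by rewrite -[in LHS](prednK l_gt0) intS addrC.
  have unposE z : unpos z = z + n%:Z * (b.+1%:Z - 1)
                            + (n * l.-1)%N%:Z * ((z - 1) %/ n)%Z.
    have := divz_eq (z - 1) n; rewrite /unpos /idx_of.
    move: ((z - 1) %/ n)%Z ((z - 1) %% n)%Z => t u zE.
    have -> : z = t * n%:Z + u + 1 by rewrite -zE subrK.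
    by rewrite !PoszM lE; ring.
  rewrite !unposE ltr_leD ?ltrD2r // ler_wpM2l // lez_pdiv2r //.
  by move: yy'; clear; lia.
- exact: (Qk b).
Qed.

Lemma bar_fock_n bar sn v : is_bar_involution bar ->
  @fock_n n l s sn v -> fock_n sn (bar v).
Proof.
move=> bar_inv; apply: (bar_stable bar_inv (Q := fun k => has_charges_n l s k sn)).
  move=> k k' kk' Qk a; apply: is_charge_ext (Qk a) => y.
  by split=> -[i]; rewrite (kk', esym (kk' i)) => ?; exists i.
move=> r k k' [kr dec gt_k] [k'r dec' gt_k'] /andP[cols _] Qk a.
have aP : 1 <= a.+1%:Z <= n%:Z by have := ltn_ord a; lia.
pose unpos (y : int) :=
  idx_of n l a.+1%:Z (((y - 1) %% l)%Z + 1) (- ((y - 1) %/ l)%Z).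
have bP (y : int) : 1 <= ((y - 1) %% l)%Z + 1 <= l%:Z.
  have lz : l%:Z != 0 by lia.
  by have := modz_ge0 (y - 1) lz; have := ltz_mod (y - 1) lz; lia.
apply: (@charge_same_colours (idx_a n)
   (fun z => idx_b n l z - l%:Z * idx_m n l z) unpos a.+1%:Z
   _ _ _ _ k) => //; rewrite ?kr ?k'r //.
- by move=> y; have [] := idx_ofK (- ((y - 1) %/ l)%Z) aP (bP y).
- move=> y; have [_ -> ->] := idx_ofK (- ((y - 1) %/ l)%Z) aP (bP y).
  by have := divz_eq (y - 1) l; lia.
- move=> z za; have [_ zbP zE] := idx_of_surj z n_gt0 l_gt0.
  rewrite -[RHS]zE za /unpos.
  have -> : idx_b n l z - l%:Z * idx_m n l z - 1 =
            - idx_m n l z * l%:Z + (idx_b n l z - 1).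
    by ring.
  have lz : l%:Z != 0 by lia.
  rewrite modzMDl divzMDl // modz_small ?divz_small; [|lia|lia].
  by rewrite subrK addr0 opprK.
- move=> y y' yy'.
  have unposE z : unpos z = a.+1%:Z + n%:Z * (z - 1).
    by rewrite [in RHS](divz_eq (z - 1) l) /unpos /idx_of PoszM; ring.
  by rewrite !unposE ltrD2l ltr_pM2l ?ltrD2r.
- exact: (Qk a).
Qed.

End Wedge.

(** * Compatibility of the bar involution with the operators and subspaces *)

Theorem theorem3p2 (n l : nat) (s : int) (hn : (1 < n)%N) (hl : (1 < l)%N)
    (bar : semi_wedge n l s -> semi_wedge n l s)
    (hbar : is_bar_involution bar)
    (f : 'I_n -> {linear semi_wedge n l s -> semi_wedge n l s})
    (hf : forall i : 'I_n, is_lowering_a i (f i))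
    (f' : 'I_l -> {linear semi_wedge n l s -> semi_wedge n l s})
    (hf' : forall j : 'I_l, is_lowering_b j (f' j))
    (B : int -> {linear semi_wedge n l s -> semi_wedge n l s})
    (hB : forall m : int, m != 0 -> is_heisenberg m (B m)) :
  (forall v : semi_wedge n l s,
     [/\ forall i : 'I_n, bar (f i v) = f i (bar v),
         forall j : 'I_l, bar (f' j v) = f' j (bar v)
       & forall m : int, 0 < m -> bar (B (- m) v) = B (- m) (bar v)]) /\
  (forall (sl : 'I_l -> int) (sn : 'I_n -> int),
     \sum_(b < l) sl b = s -> \sum_(a < n) sn a = s ->
     (forall v, fock_l sl v -> fock_l sl (bar v)) /\
     (forall v, fock_n sn v -> fock_n sn (bar v))).

Proof.
have n_gt0 : (0 < n)%N := ltnW hn; have l_gt0 : (0 < l)%N := ltnW hl.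
split=> [v|sl sn _ _]; split.
- by move=> i; apply: bar_lowering_a (hf i) v.
- by move=> j; apply: bar_lowering_b (hf' j) v.
- move=> m m_gt0; apply: (bar_heisenberg n_gt0 l_gt0 hbar m_gt0).
  by apply: hB; rewrite oppr_eq0 gt_eqF.
- by move=> v; apply: bar_fock_l.
- by move=> v; apply: bar_fock_n.
Qed.
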